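(* For a single-block warehouse, each subaisle is traversed at most once by any optimal walk.
   Context: **Single-block warehouse.** There are $n\ge1$ parallel vertical aisles (here each aisle is a single subaisle) and two horizontal cross-aisles. Aisle $i$ has a northern artificial location $u_i$ (on the first cross-aisle) and a southern artificial location $d_i$ (on the second cross-aisle), and finitely many picking locations $v_{i1},\dots,v_{is_i}$ listed from north to south, lying strictly between $u_i$ and $d_i$. The warehouse graph is undirected with an edge between any two neighboring locations within an aisle and edges $[u_i,u_{i+1}]$, $[d_i,d_{i+1}]$ for $1\le i<n$. Edge lengths are the (positive) distances; the layout is rectangular, so all aisles have the same total length and $[u_i,u_{i+1}]$ and $[d_i,d_{i+1}]$ have the same length. The origin is $s=u_1$. $V_L$ denotes the set of all picking locations. **Optimal walk.** Given a set $R\subseteq V_L$ of picking locations a picker has to visit, a picking walk is a closed walk in the warehouse graph that starts and ends at $s$ and visits every vertex of $R$ (vertices and edges may be repeated). It is optimal if its total length is minimum among such walks. **Traversing** a subaisle means going (without reversing) from its northern artificial location to its southern artificial location or vice versa, i.e. each occurrence in the walk of the consecutive subpath $u_i,v_{i1},\dots,v_{is_i},d_i$ or of its reverse counts as one traversal of subaisle $i$. *)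

(* Defs.v *)
From HB Require Import structures.
From mathcomp Require Import all_boot all_order all_algebra.
Set Implicit Arguments.
Unset Strict Implicit.
Unset Printing Implicit Defensive.
Import Order.TTheory GRing.Theory Num.Theory.
Local Open Scope ring_scope.

(* Aisle i has the locations 0, ..., npick i + 1 from north to south: location
   0 is u_i, location npick i + 1 is d_i, and location j with 1 <= j <= npick i
   is v_{ij}. The edge between locations j and j+1 of aisle i has length
   vlen i j. The edges [u_k, u_{k+1}] and [d_k, d_{k+1}] (aisles counted from 0)
   have lengths nlen k and slen k. The values of the length functions outside
   of these ranges are unconstrained and never used. *)
Record warehouse (R : realFieldType) := Warehouse {
  naisles : nat;
  naisles_gt0 : (0 < naisles)%N;
  npick : 'I_naisles -> nat;
  vlen : 'I_naisles -> nat -> R;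
  nlen : nat -> R;
  slen : nat -> R;
  vlen_gt0 : forall i j, (j <= npick i)%N -> 0 < vlen i j;
  nlen_gt0 : forall k, (k.+1 < naisles)%N -> 0 < nlen k;
  slen_gt0 : forall k, (k.+1 < naisles)%N -> 0 < slen k;
  same_aisle_length : forall i i' : 'I_naisles,
    \sum_(j < (npick i).+1) vlen i j = \sum_(j < (npick i').+1) vlen i' j;
  same_cross_length : forall k, (k.+1 < naisles)%N -> nlen k = slen k
}.

Section Warehouse.
Variables (R : realFieldType) (W : warehouse R).

Definition location := {i : 'I_(naisles W) & 'I_(npick i).+2}.

Definition aisle_of (x : location) : 'I_(naisles W) := tag x.
Definition rank_of (x : location) : nat := tagged x.

Definition loc (i : 'I_(naisles W)) (j : 'I_(npick i).+2) : location :=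
  Tagged (fun i => 'I_(npick i).+2) j.
Definition north (i : 'I_(naisles W)) : location := loc (i := i) ord0.
Definition south (i : 'I_(naisles W)) : location := loc (i := i) ord_max.

Definition origin : location := north (Ordinal (naisles_gt0 W)).

Definition picking_locations : {set location} :=
  [set x | (0 < rank_of x <= npick (aisle_of x))%N].

Definition consecutive (a b : nat) : bool := (a.+1 == b) || (b.+1 == a).

Definition both_north (x y : location) : bool :=
  (x == north (aisle_of x)) && (y == north (aisle_of y)).
Definition both_south (x y : location) : bool :=
  (x == south (aisle_of x)) && (y == south (aisle_of y)).

Definition adj : rel location := fun x y =>
  if aisle_of x == aisle_of y then consecutive (rank_of x) (rank_of y)
  else consecutive (aisle_of x) (aisle_of y)
       && (both_north x y || both_south x y).

(* Only meaningful when adj x y holds. *)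
Definition edge_length (x y : location) : R :=
  if aisle_of x == aisle_of y then
    vlen (aisle_of x) (minn (rank_of x) (rank_of y))
  else if both_north x y then nlen W (minn (aisle_of x) (aisle_of y))
  else slen W (minn (aisle_of x) (aisle_of y)).

(* A walk is the sequence of all its vertices, both endpoints included; the
   trivial walk at the origin is [:: origin]. *)
Definition walk_length (w : seq location) : R :=
  \sum_(e <- zip w (behead w)) edge_length e.1 e.2.

Definition picking_walk (Q : {set location}) (w : seq location) : Prop :=
  exists p : seq location,
    [/\ w = origin :: p, path adj origin p, last origin p = origin
      & {subset Q <= w}].

Definition optimal_walk (Q : {set location}) (w : seq location) : Prop :=
  picking_walk Q w /\
  forall w', picking_walk Q w' -> walk_length w <= walk_length w'.

Definition subaisle (i : 'I_(naisles W)) : seq location :=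
  [seq loc j | j <- enum 'I_(npick i).+2].

(* Number of positions of w at which a (nonempty) contiguous copy of p starts;
   overlapping copies are all counted, so that u, v, d, v, u contains two
   traversals. *)
Definition occurrences (p w : seq location) : nat :=
  count (fun k => prefix p (drop k w)) (iota 0 (size w)).

Definition traversals (i : 'I_(naisles W)) (w : seq location) : nat :=
  (occurrences (subaisle i) w + occurrences (rev (subaisle i)) w)%N.

End Warehouse.

(* Main.v *)
Require Import Defs.
From mathcomp Require Import all_boot all_order all_algebra.
From mathcomp Require Import zify lra.

Set Implicit Arguments.
Unset Strict Implicit.
Unset Printing Implicit Defensive.
Import Order.TTheory GRing.Theory Num.Theory.

(** An optimal walk makes no step x -> y twice: between the two steps it runs
from y to x, and running through this part backwards makes both steps
superfluous. So aisle i is traversed at most once in each direction. If it is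
traversed in both, then, up to rotation, the walk goes down aisle i, makes a
loop X at d_i, goes up aisle i and makes a loop Y at u_i. The loop X leaves for
d_k with k = i + 1 or k = i - 1, and it comes back from d_k. As both
cross-aisles and all aisles have equal lengths, replacing the step d_k -> d_i
by u_k -> u_i and the traversal up aisle i by one up aisle k keeps the walk
optimal. Then the rest S of X at d_k can only go on to the next aisle on the
same side, so that the traversal can be moved further in the same way, until
there is no next aisle. *)

(** * Walks, given by a start [x] and the list [p] of the later vertices, and their reversal *)

Section Steps.
Variable T : eqType.
Implicit Types (x y : T) (p q : seq T).

Definition steps x p : seq (T * T) := zip (x :: p) p.

Lemma steps_cons x y p : steps x (y :: p) = (x, y) :: steps y p.
Proof. by []. Qed.

Lemma steps_cat x p q : steps x (p ++ q) = steps x p ++ steps (last x p) q.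
Proof. by elim: p x => //= y p IH x; rewrite !steps_cons IH. Qed.

Lemma stepsP x p a b :
  reflect (exists p1 p2, p = p1 ++ b :: p2 /\ last x p1 = a)
          ((a, b) \in steps x p).
Proof.
apply: (iffP idP) => [|[p1 [p2 [-> <-]]]].
  elim: p x => // y p IH x; rewrite steps_cons inE => /orP[/eqP[-> ->]|/IH].
    by exists [::], p.
  by case=> p1 [p2 [-> <-]]; exists (y :: p1), p2.
by rewrite steps_cat mem_cat steps_cons mem_head orbT.
Qed.

(** The reversed walk starts at [last x p], which is left out of the list just as [x] is left out of
    [p]. *)
Definition backward x p : seq T := rev (belast x p).

Lemma backward_cons x y p : backward x (y :: p) = rcons (backward y p) x.
Proof. by rewrite /backward /= rev_cons. Qed.

Lemma last_backward x p : last (last x p) (backward x p) = x.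
Proof. by case: p => //= y p; rewrite backward_cons last_rcons. Qed.

Lemma backwardE x p : last x p :: backward x p = rev (x :: p).
Proof. by rewrite [x :: p]lastI rev_rcons. Qed.

Lemma steps_backward x p :
  steps (last x p) (backward x p) = rev [seq (e.2, e.1) | e <- steps x p].
Proof.
elim: p x => // y p IH x.
rewrite backward_cons -cats1 steps_cat [last x _]/= IH last_backward.
by rewrite steps_cons /= rev_cons -cats1.
Qed.

Lemma path_exit (e : rel T) (C : pred T) x p :
    path e x p -> C x -> ~~ C (last x p) ->
  exists a b, [/\ (a, b) \in steps x p, e a b, C a & ~~ C b].
Proof.
elim: p x => [|y p IH] x /=; first by move=> _ ->.
case/andP=> exy pp Cx Cl; case: (boolP (C y)) => [Cy|NCy].
  have [a [b [ab eab Ca Cb]]] := IH y pp Cy Cl.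
  by exists a, b; rewrite steps_cons inE ab orbT.
by exists x, y; rewrite steps_cons mem_head.
Qed.

End Steps.

(** * Exchange arguments for optimal closed walks in a weighted undirected graph *)

Section OptimalClosedWalks.
Local Open Scope ring_scope.
Variables (R : realFieldType) (T : eqType) (e : rel T) (len : T -> T -> R).
Hypotheses (eC : symmetric e) (lenC : forall x y, len x y = len y x).
Hypothesis len_gt0 : forall x y, e x y -> 0 < len x y.
Implicit Types (x y z : T) (p q : seq T).

Definition path_length x p : R := \sum_(a <- steps x p) len a.1 a.2.

Lemma path_length_cons x y p :
  path_length x (y :: p) = len x y + path_length y p.
Proof. by rewrite /path_length steps_cons big_cons. Qed.

Lemma path_length_cat x p q :
  path_length x (p ++ q) = path_length x p + path_length (last x p) q.
Proof. by rewrite /path_length steps_cat big_cat. Qed.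

Lemma path_backward x p : path e x p -> path e (last x p) (backward x p).
Proof.
rewrite /backward rev_path => pp.
by rewrite (@eq_path _ _ e) => [|a b]; last exact: eC.
Qed.

Lemma path_length_backward x p :
  path_length (last x p) (backward x p) = path_length x p.
Proof.
rewrite /path_length steps_backward (perm_big _ (permEl (perm_rev _))) big_map.
by apply: eq_bigr => a _; rewrite lenC.
Qed.

Variable Q : {pred T}.

Definition closed_walk x p : Prop :=
  [/\ path e x p, last x p = x & {subset Q <= x :: p}].

(** Competitors may start at any vertex, which makes optimality invariant under rotation of the
    walk. *)
Definition optimal_closed_walk x p : Prop :=
  closed_walk x p /\
  forall y q, closed_walk y q -> path_length x p <= path_length y q.

Local Notation opt := optimal_closed_walk.

Lemma closed_walk_rotate x p q :
  closed_walk x (p ++ q) -> closed_walk (last x p) (q ++ p).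
Proof.
case=> pp lx Qx; split.
- by move: pp; rewrite !cat_path -last_cat lx andbC.
- by rewrite last_cat -[last (last _ _) q]last_cat lx.
- move=> z /Qx; rewrite inE !mem_cat => /or3P[/eqP->|zp|zq]; last 2 first.
  + by rewrite inE mem_cat zp !orbT.
  + by rewrite inE mem_cat zq !orbT.
  + by rewrite -cat_cons mem_cat -{1}lx last_cat mem_last.
Qed.

Lemma path_length_rotate x p q : last x (p ++ q) = x ->
  path_length (last x p) (q ++ p) = path_length x (p ++ q).
Proof. by move=> lx; rewrite !path_length_cat -last_cat lx addrC. Qed.

Lemma optimal_rotate x p q : opt x (p ++ q) -> opt (last x p) (q ++ p).
Proof.
case=> c o; split; first exact: closed_walk_rotate.
by case: c => _ lx _; rewrite path_length_rotate.
Qed.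

Lemma optimal_replace x p y q :
    opt x p -> closed_walk y q -> path_length y q <= path_length x p -> opt y q.
Proof. by move=> [_ o] cq le; split=> // z r /o; apply: le_trans. Qed.

Lemma optimal_first_step x y p : opt x (y :: p) -> (x, y) \notin steps y p.
Proof.
move=> o; apply/negP => /stepsP[p1 [p2 [def_p lp1]]]; subst p.
have [[pp lp sub] o'] := o.
move: pp; rewrite /= cat_path /= lp1 => /and4P[xy pp1 _ pp2].
move: lp; rewrite /= last_cat /= => lp2.
have bw := path_backward pp1; rewrite lp1 in bw.
have lb := last_backward y p1; rewrite lp1 in lb.
have lenb := path_length_backward y p1; rewrite lp1 in lenb.
(* The competitor goes from [x] backwards along [p1] to [y] and on along [p2]. It visits the same
   vertices and saves the edge between [x] and [y] twice. *)
suff: path_length x (y :: p1 ++ y :: p2) <= path_length x (backward y p1 ++ p2).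
  rewrite path_length_cons !path_length_cat path_length_cons lp1 lb lenb.
  by have := len_gt0 xy; lra.
apply: o'; split.
- by rewrite cat_path bw lb.
- by rewrite last_cat lb.
- have def_b: x :: backward y p1 = rev (y :: p1) by rewrite -backwardE lp1.
  rewrite -cat_cons def_b => z /sub; rewrite mem_cat mem_rev inE.
  case/predU1P=> [->|]; first by rewrite -lp1 mem_last.
  rewrite -cat_cons mem_cat (in_cons y p2).
  by case/or3P=> [->|/eqP->|->]; rewrite ?mem_head ?orbT.
Qed.

(** Rotation turns any step into the first one; the induction runs over the suffixes of [p]. *)
Lemma optimal_uniq_steps x p : opt x p -> uniq (steps x p).
Proof.
move=> o; suff: forall q r, p = r ++ q -> uniq (steps (last x r) q).
  exact: (fun h => h p [::] erefl).
elim=> // y q IH r def_p; rewrite steps_cons /=.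
have/IH: p = rcons r y ++ q by rewrite cat_rcons.
rewrite last_rcons => ->; rewrite andbT.
rewrite def_p in o; have := optimal_first_step (optimal_rotate o).
by rewrite steps_cat mem_cat; case/norP.
Qed.

Lemma optimal_reverse_loop x p q :
  last x p = x -> opt x (p ++ q) -> opt x (backward x p ++ q).
Proof.
move=> lp o; have [[pp lq sub] _] := o.
move: pp lq; rewrite cat_path last_cat => /andP[/path_backward pb pq] lq.
have lb := last_backward x p; have lenb := path_length_backward x p.
have be := backwardE x p.
rewrite !lp in lb pb pq lq lenb be; apply: optimal_replace o _ _.
  split; first by rewrite cat_path pb lb.
    by rewrite last_cat lb.
  by move=> z /sub; rewrite -!cat_cons !mem_cat be mem_rev.
by rewrite !path_length_cat lb lenb lp.
Qed.

(** A repetition in the same direction contradicts [optimal_uniq_steps]. One in the opposite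
    direction becomes such a repetition once the loop [p] is reversed. *)
Lemma optimal_loop x p q a b :
    opt x (p ++ q) -> last x p = x -> (a, b) \in steps x p ->
  ((a, b) \notin steps x q) /\ ((b, a) \notin steps x q).
Proof.
move=> o lp ab; split; apply/negP => abq.
  have := optimal_uniq_steps o; rewrite steps_cat lp cat_uniq.
  by case/and3P=> _ /hasP[]; exists (a, b).
have := optimal_uniq_steps (optimal_reverse_loop lp o).
have sb := steps_backward x p; have lb := last_backward x p.
rewrite !lp in sb lb; rewrite steps_cat lb sb cat_uniq.
case/and3P=> _ /hasP[]; exists (b, a) => //=.
by rewrite mem_rev; apply/mapP; exists (a, b).
Qed.

End OptimalClosedWalks.

(** * Edges of the warehouse, and runs along an aisle *)

Section WarehouseGraph.
Local Open Scope ring_scope.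
Variables (R : realFieldType) (W : warehouse R).
Implicit Types (x y z : location W) (i k : 'I_(naisles W)).

Lemma consecutiveC : symmetric consecutive.
Proof. by move=> a b; rewrite /consecutive orbC. Qed.

Lemma both_northC x y : both_north x y = both_north y x.
Proof. exact: andbC. Qed.

Lemma adjC : symmetric (@adj R W).
Proof.
move=> x y; rewrite /adj eq_sym (consecutiveC (rank_of x)) both_northC.
by rewrite (consecutiveC (aisle_of x)) /both_south (andbC (x == _)).
Qed.

Lemma edge_lengthC x y : edge_length x y = edge_length y x.
Proof.
rewrite /edge_length eq_sym both_northC minnC (minnC (aisle_of x)).
by case: eqP => // ->.
Qed.

Lemma edge_length_gt0 x y : adj x y -> 0 < edge_length x y.
Proof.
rewrite /adj /edge_length; case: eqP => [axy cxy | _ /andP[cxy _]].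
  apply: vlen_gt0; have := ltn_ord (tagged x); have := ltn_ord (tagged y).
  move: cxy; rewrite /consecutive -/(rank_of x) -/(rank_of y).
  by rewrite -!/(aisle_of _) -axy; lia.
have lt_min: ((minn (aisle_of x) (aisle_of y)).+1 < naisles W)%N.
  have := ltn_ord (aisle_of x); have := ltn_ord (aisle_of y).
  by move: cxy; rewrite /consecutive; lia.
by case: ifP => _; [apply: nlen_gt0 | apply: slen_gt0].
Qed.

Lemma south_neq_north i k : (south i == north k) = false.
Proof. by apply/eqP => /(congr1 (@rank_of R W)). Qed.

Lemma south_inj : injective (@south R W).
Proof. by move=> i k /(congr1 (@aisle_of R W)). Qed.

(** The rank is a plain number, to allow arithmetic; [inord] sends values out of range to rank 0,
    hence the bounds in the lemmas below. *)
Definition nth_location i (t : nat) : location W := loc (i := i) (inord t).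

Lemma rank_nth_location i t :
  (t <= (npick i).+1)%N -> rank_of (nth_location i t) = t.
Proof. exact: inordK. Qed.

Lemma nth_location_inj i t u :
    (t <= (npick i).+1)%N -> (u <= (npick i).+1)%N ->
  nth_location i t = nth_location i u -> t = u.
Proof.
by move=> ti ui /(congr1 (@rank_of R W)); rewrite !rank_nth_location.
Qed.

Lemma nth_location0 i : nth_location i 0 = north i.
Proof. by congr loc; apply: val_inj; rewrite /= inordK. Qed.

Lemma nth_location_last i : nth_location i (npick i).+1 = south i.
Proof. by congr loc; apply: val_inj; rewrite /= inordK. Qed.

Lemma subaisleE i :
  subaisle i = [seq nth_location i t | t <- iota 0 (npick i).+2].
Proof.
rewrite /subaisle -val_enum_ord -map_comp; apply: eq_map => j /=.
by rewrite /nth_location inord_val.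
Qed.

Lemma path_aisle i a m : (a + m <= (npick i).+1)%N ->
  let p := [seq nth_location i t | t <- iota a.+1 m] in
  [/\ path (@adj R W) (nth_location i a) p,
      last (nth_location i a) p = nth_location i (a + m) &
      path_length (@edge_length R W) (nth_location i a) p
        = \sum_(a <= j < a + m) vlen i j].
Proof.
elim: m a => [|m IH] a le_am /=.
  by rewrite addn0 big_geq // /path_length big_nil.
have [|pp lp ep] := IH a.+1; first by rewrite addSnnS.
rewrite path_length_cons pp lp ep addSnnS andbT; split=> //.
  by rewrite /adj eqxx !rank_nth_location /consecutive ?eqxx //; lia.
rewrite [RHS]big_ltn ?addnS ?ltnS ?leq_addr //.
congr (_ + _); rewrite /edge_length eqxx !rank_nth_location; try lia.
by rewrite (minn_idPl _).
Qed.

Definition upper i := [seq nth_location i t | t <- iota 1 (npick i)].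
(** The neighbour of [south i] within the aisle; it is [north i] if there is no picking location. *)
Definition above i := nth_location i (npick i).
Definition down i := rcons (upper i) (south i).
Definition up i := backward (north i) (down i).

Lemma last_upper i : last (north i) (upper i) = above i.
Proof. by rewrite -nth_location0; case: (@path_aisle i 0 (npick i)). Qed.

Lemma downE i : down i = [seq nth_location i t | t <- iota 1 (npick i).+1].
Proof.
by rewrite -[(npick i).+1]addn1 iotaD map_cat /= cats1 nth_location_last.
Qed.

Lemma subaisle_down i : subaisle i = north i :: down i.
Proof. by rewrite subaisleE downE /= nth_location0. Qed.

Lemma path_down i : path (@adj R W) (north i) (down i).
Proof.
by rewrite downE -nth_location0; case: (@path_aisle i 0 (npick i).+1).
Qed.

Lemma last_down i : last (north i) (down i) = south i.
Proof. by rewrite last_rcons. Qed.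

Lemma rev_subaisle i : rev (subaisle i) = south i :: up i.
Proof. by rewrite subaisle_down -backwardE last_down. Qed.

Lemma upE i : up i = above i :: backward (north i) (upper i).
Proof.
by rewrite /up /down /backward belast_rcons lastI rev_rcons last_upper.
Qed.

Lemma path_up i : path (@adj R W) (south i) (up i).
Proof. by have := path_backward adjC (path_down i); rewrite last_down. Qed.

Lemma last_up i : last (south i) (up i) = north i.
Proof. by rewrite -[in LHS](last_down i) last_backward. Qed.

Lemma path_length_up i : path_length (@edge_length R W) (south i) (up i)
  = path_length (@edge_length R W) (north i) (down i).
Proof. by rewrite -{1}(last_down i) (path_length_backward edge_lengthC). Qed.

Lemma path_length_down i k : path_length (@edge_length R W) (north i) (down i)
  = path_length (@edge_length R W) (north k) (down k).
Proof.
have len_down j : path_length (@edge_length R W) (north j) (down j)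
    = \sum_(t < (npick j).+1) vlen j t.
  rewrite downE -nth_location0.
  by case: (@path_aisle j 0 (npick j).+1) => // _ _ ->; rewrite big_mkord.
by rewrite !len_down (same_aisle_length i k).
Qed.

Lemma adj_cross x y : adj x y -> aisle_of x != aisle_of y ->
  consecutive (aisle_of x) (aisle_of y) /\
  ((x = north (aisle_of x) /\ y = north (aisle_of y)) \/
   (x = south (aisle_of x) /\ y = south (aisle_of y))).
Proof.
rewrite /adj => + /negPf axy; rewrite axy => /andP[cxy].
by case/orP=> /andP[/eqP xE /eqP yE]; split=> //; [left | right].
Qed.

Lemma adj_southP i y : adj (south i) y ->
  y = above i \/ exists2 k : 'I_(naisles W), consecutive i k & y = south k.
Proof.
move=> iy; have [eq_iy | neq_iy] := eqVneq (aisle_of (south i)) (aisle_of y).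
  left; move: iy; rewrite /adj eq_iy eqxx; case: y eq_iy => k j /= eq_ik.
  rewrite /aisle_of /= in eq_ik; subst k.
  have := ltn_ord j; rewrite /consecutive /rank_of /= => lt_j c_j.
  by congr loc; apply: val_inj; rewrite /= inordK; lia.
have [c [[/eqP] | [_ ->]]] := adj_cross iy neq_iy.
  by rewrite south_neq_north.
by right; exists (aisle_of y).
Qed.

Lemma consecutive_neq i k : consecutive i k -> (i == k) = false.
Proof.
by move=> c; apply/eqP => eq_ik; move: c; rewrite eq_ik /consecutive; lia.
Qed.

Lemma adj_north i k : consecutive i k -> adj (north i) (north k).
Proof.
move=> c; rewrite /adj /both_north !eqxx /= andbT.
by rewrite (consecutive_neq c : (aisle_of (north i) == _) = _).
Qed.

Lemma adj_south i k : consecutive i k -> adj (south i) (south k).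
Proof.
move=> c; rewrite /adj /both_south !eqxx /= orbT andbT.
by rewrite (consecutive_neq c : (aisle_of (south i) == _) = _).
Qed.

Lemma edge_length_cross i k : consecutive i k ->
  edge_length (north i) (north k) = edge_length (south i) (south k).
Proof.
move=> c; rewrite /edge_length /both_north !eqxx !south_neq_north.
rewrite (consecutive_neq c : (aisle_of (north i) == _) = _).
apply: same_cross_length.
by have := ltn_ord i; have := ltn_ord k; move: c; rewrite /consecutive /=; lia.
Qed.

End WarehouseGraph.

(** * Arithmetic of aisle numbers *)

(** An induction measure for moving from [a] over [b] in a fixed direction. It counts [b] itself
    only when moving to the right, which is harmless as the direction never changes. *)
Definition columns_beyond (N a b : nat) : nat :=
  if (a < b)%N then N - b else b.

Lemma columns_beyond_ltn N a b c : (b < N)%N ->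
    consecutive a b -> consecutive b c -> c != a ->
  (columns_beyond N b c < columns_beyond N a b)%N.
Proof.
rewrite /columns_beyond /consecutive.
by case: (ltnP a b); case: (ltnP b c); lia.
Qed.

Lemma consecutive_unique a b c d :
    consecutive a b -> consecutive b c -> c != a -> consecutive b d -> d != a ->
  c = d.
Proof. by rewrite /consecutive; lia. Qed.

Definition beyond (a b c : nat) : bool :=
  if (a < b)%N then (a < c)%N else (c < a)%N.

Lemma beyond_next a b : consecutive a b -> beyond a b b.
Proof. by rewrite /beyond /consecutive; case: (ltnP a b); lia. Qed.

Lemma beyond_irrefl a b : ~~ beyond a b a.
Proof. by rewrite /beyond ltnn; case: ifP. Qed.

(** The aisles on the side of [b] form a cut whose only crossings join [a] and [b]. *)
Lemma beyond_crossing a b c d :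
    consecutive a b -> consecutive c d -> beyond a b c -> ~~ beyond a b d ->
  c = b /\ d = a.
Proof. by rewrite /beyond /consecutive; case: (ltnP a b); lia. Qed.

(** * No aisle is traversed in both directions *)

Section OptimalPickingWalks.
Local Open Scope ring_scope.
Variables (R : realFieldType) (W : warehouse R) (Q : {pred location W}).
Hypothesis Q_south : forall i, south i \notin Q.
Implicit Types (x y z : location W) (i k : 'I_(naisles W)).

Local Notation opt := (optimal_closed_walk (@adj R W) (@edge_length R W) Q).
Local Notation plen := (path_length (@edge_length R W)).
Let loop_steps := @optimal_loop _ _ _ _ (@adjC R W)
  (@edge_lengthC R W) (@edge_length_gt0 R W) Q.

(* This is the walk of the header after the traversal has been moved to aisle k.
   The last hypothesis says that aisle k itself need not be traversed. *)
Lemma no_shifted_traversal i k Z S :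
    consecutive i k ->
    opt (north k) (north i :: Z ++ south k :: S ++ up k) ->
    last (north i) Z = south i -> last (south k) S = south k ->
    {subset Q <= north i :: Z ++ south k :: S} ->
  False.
Proof.
(* Induction on the number of aisles left in the direction from [i] to [k]. *)
have [n] := ubnP (columns_beyond (naisles W) i k).
elim: n i k Z S => // n IH i k Z S le_n cik o lZ lS QS.
have [[pp _ _] min_o] := o.
move: pp; rewrite /= cat_path /= cat_path lZ lS => /and5P[ki pZ ik pS pup].
have e_ik := edge_length_cross cik.
have e_ki := edge_lengthC (north k) (north i).
have gt0_ik : 0 < edge_length (south i) (south k) := edge_length_gt0 ik.
case: S => [|y S] in o lS QS pS min_o *.
  (* With [S] empty, the detour to aisle [k] is pointless: going up aisle [i] directly saves both
     cross edges and loses only [south k] and the inside of aisle [k], where nothing else needs a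
     visit. *)
  suff /min_o : closed_walk (@adj R W) Q (north i) (Z ++ up i).
    rewrite /= path_length_cons !path_length_cat path_length_cons lZ.
    by rewrite !path_length_up (path_length_down i k); lra.
  split; first by rewrite cat_path pZ lZ path_up.
    by rewrite last_cat lZ last_up.
  move=> z Qz; have := QS z Qz; rewrite -cat_cons mem_cat mem_seq1.
  case/orP=> [zZ|/eqP zk]; first by rewrite -cat_cons mem_cat zZ.
  by have := Q_south k; rewrite -zk Qz.
pose A := north i :: Z ++ [:: south k].
have lA : last (north k) A = south k by rewrite /= last_cat.
(* In the rotated walk, [S] is a loop at [south k], and [up k ++ A] is the rest. *)
have oloop : opt (south k) ((y :: S) ++ (up k ++ A)).
  rewrite catA -lA; apply: optimal_rotate; move: o.
  by rewrite /A -[in X in _ -> X]cat1s -!catA.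
have kab : (south k, above k) \in steps (south k) (up k ++ A).
  by rewrite upE steps_cons mem_head.
have ikA : (south i, south k) \in steps (south k) (up k ++ A).
  apply/stepsP; exists (up k ++ north i :: Z), [::]; split.
    by rewrite -catA.
  by rewrite last_cat.
(* The rest uses the edges from [south k] to [above k] and to [south i], so by [optimal_loop] the
   loop uses them in neither direction. Only the next aisle on the far side remains as its first and
   last neighbour. *)
have step_south z : (south k, z) \in steps (south k) (y :: S)
    \/ (z, south k) \in steps (south k) (y :: S) -> adj (south k) z ->
  exists2 k' : 'I_(naisles W), consecutive k k' /\ k' != i & z = south k'.
  move=> zS /adj_southP[zE | [k' ckk' zE]]; rewrite zE in zS *.
    by case: zS => /(loop_steps oloop lS)[]; rewrite kab.
  exists k' => //; split=> //; apply/eqP => eq_i; rewrite eq_i in zS.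
  by case: zS => /(loop_steps oloop lS)[]; rewrite ikA.
move: pS; rewrite /= => /andP[ky pS].
have [k1 [ck1 nk1] yE] : exists2 k' : 'I_(naisles W),
    consecutive k k' /\ k' != i & y = south k'.
  by apply: step_south ky; left; rewrite steps_cons mem_head.
case/lastP: S => [|T z] in o lS QS pS min_o oloop step_south *.
  have := consecutive_neq ck1; move: lS.
  by rewrite /= yE => /south_inj->; rewrite eqxx.
have lT : z = south k by move: lS; rewrite /= last_rcons.
rewrite {z}lT in o lS QS pS min_o oloop step_south.
move: pS; rewrite rcons_path => /andP[pT Tk].
have [k2 [ck2 nk2] lTE] : exists2 k' : 'I_(naisles W),
    consecutive k k' /\ k' != i & last y T = south k'.
  apply: step_south; last by rewrite adjC.
  by right; apply/stepsP; exists (y :: T), [::]; rewrite /= cats1.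
have {ck2 nk2 k2}lTE : last (south k1) T = south k1.
  rewrite -[in LHS]yE lTE; congr south; apply: val_inj.
  exact: (consecutive_unique cik ck2 nk2 ck1 nk1).
have pA : path (@adj R W) (north k) A.
  by rewrite /A /= ki cat_path pZ lZ /= ik.
have lenA : plen (north k) A =
    edge_length (north k) (north i)
      + (plen (north i) Z + edge_length (south i) (south k)).
  rewrite /A path_length_cons path_length_cat lZ path_length_cons.
  by rewrite /path_length big_nil addr0.
have QA z : z \in Q -> (z \in A) || (z \in south k1 :: T).
  move=> /QS; rewrite yE /A !(inE, mem_cat, mem_rcons).
  by do ![case/orP | move=> ->; rewrite ?orbT //].
clearbody A.
(* The new walk trades the step from [south k1] to [south k] for the one from [north k1] to
   [north k], and [up k] for [up k1]. *)
have le_len : plen (north k1) (north k :: A ++ south k1 :: T ++ up k1)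
    <= plen (north k)
         (north i :: Z ++ south k :: rcons (y :: T) (south k) ++ up k).
  rewrite -cats1 !(path_length_cons, path_length_cat) lA lZ lTE yE /=.
  rewrite last_cat /= lTE lenA !path_length_up.
  rewrite (path_length_down k1 k) (edge_lengthC (north k1)).
  rewrite (edge_length_cross ck1) (edge_lengthC (south k1)).
  by rewrite /path_length big_nil; lra.
subst y; apply: (IH k k1 A T) => //.
- have := columns_beyond_ltn (ltn_ord k) cik ck1 nk1.
  by move/leq_trans; apply; rewrite -ltnS.
- apply: optimal_replace o _ le_len; split.
  + rewrite /= cat_path /= cat_path lA lTE pT adj_north 1?consecutiveC //=.
    by rewrite pA ky path_up.
  + by rewrite /= last_cat /= last_cat lTE last_up.
  + move=> z /QA QAz; rewrite 2!in_cons mem_cat -[_ :: T ++ _]cat_cons mem_cat.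
    by case/orP: QAz => ->; rewrite ?orbT.
- by move=> z /QA QAz; rewrite in_cons mem_cat QAz orbT.
Qed.

(** The walk is rearranged into the form that [no_shifted_traversal] excludes, with the traversal
    upwards moved to the first aisle that [X] enters. *)
Lemma no_opposite_traversals i X Y :
    opt (north i) (down i ++ X ++ up i ++ Y) -> last (south i) X = south i ->
  False.
Proof.
(* If [X] met [north i], the walk up to there would be a loop using the edge between [above i] and
   [south i], which [up i] uses again outside of it. *)
move=> o lX; have N_notin_X : north i \notin X.
  apply/negP => NX; case/splitPr: X / NX o lX => X1 X2.
  rewrite last_cat /= => o lX2.
  have oloop : opt (north i)
      ((down i ++ rcons X1 (north i)) ++ (X2 ++ up i ++ Y)).
    by rewrite -cats1 -!catA; rewrite -catA in o.
  have [] := loop_steps oloop (a := above i) (b := south i).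
  - by rewrite last_cat last_rcons.
  - apply/stepsP; exists (upper i), (rcons X1 (north i)).
    by rewrite cat_rcons last_upper.
  - move=> _ /stepsP[]; exists X2, (backward (north i) (upper i) ++ Y).
    by rewrite upE lX2.
have [[pp lp sub_o] min_o] := o.
move: pp; rewrite !cat_path last_down lX last_up => /and4P[pD pX pU pY].
have lY : last (north i) Y = north i.
  by move: lp; rewrite !last_cat last_down lX last_up.
case: X => [|y X] in lp o lX N_notin_X pX sub_o min_o *.
  have ua : adj (south i) (above i) by move: pU; rewrite upE => /andP[].
  have ua0 := edge_length_gt0 ua.
  have pupper : path (@adj R W) (north i) (upper i).
    by move: pD; rewrite /down rcons_path => /andP[].
  have lb := last_backward (north i) (upper i).
  rewrite last_upper in lb.
  have pb := path_backward (@adjC R W) pupper; rewrite last_upper in pb.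
  (* With [X] empty, turning back at [above i] saves the last edge of the aisle twice and misses
     only [south i]. *)
  suff /min_o : closed_walk (@adj R W) Q (north i)
      (upper i ++ backward (north i) (upper i) ++ Y).
    rewrite upE /down cat0s -cats1.
    rewrite !(path_length_cat, path_length_cons, last_cat).
    rewrite /= last_upper lb (edge_lengthC _ (south i)) /path_length big_nil.
    by move: ua0; lra.
  split.
  - by rewrite !cat_path pupper last_upper lb pb.
  - by rewrite !last_cat last_upper lb.
  - move=> z Qz; have nz : z != south i by apply: contraNneq (Q_south i) => <-.
    have au : above i \in north i :: upper i by rewrite -last_upper mem_last.
    move: (sub_o z Qz); rewrite -!cat_cons !mem_cat -rcons_cons mem_rcons.
    rewrite in_cons (negPf nz) /= upE (in_cons (above i)).
    by case/or3P=> [->//|/orP[/eqP->|->]|->]; rewrite ?au ?orbT.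
have oloop : opt (south i) ((y :: X) ++ ((up i ++ Y) ++ down i)).
  by rewrite catA -(last_down i); apply: optimal_rotate.
move: pX => /= /andP[iy pX].
(* The loop cannot start towards [above i], because [up i] makes that step. *)
have [k cik yE] : exists2 k : 'I_(naisles W), consecutive i k & y = south k.
  have [yE|//] := adj_southP iy.
  have := loop_steps oloop (a := south i) (b := y) lX.
  by rewrite upE steps_cons mem_head => /(_ isT)[]; rewrite yE mem_head.
(* The loop has to leave the side of aisle [k] again in order to return to [south i]. A crossing on
   the north side would visit [north i], so it is the step from [south k] to [south i]. *)
have [] := path_exit (C := fun z => beyond i k (aisle_of z)) pX.
- by rewrite yE; apply: beyond_next.
- by rewrite [last _ _]lX; apply: beyond_irrefl.
move=> a [b [abX ab far_a far_b]].
have neq_ab : aisle_of a != aisle_of b.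
  by apply: contraTneq far_a => ->.
have [cab sides] := adj_cross ab neq_ab.
have [/val_inj aE /val_inj bE] := beyond_crossing cik cab far_a far_b.
rewrite {}aE {}bE in sides.
have [S [S' [XE lS]]] := stepsP _ _ _ _ abX.
case: sides => -[aE bE]; rewrite aE in lS; rewrite bE in XE; subst y X.
  by move: N_notin_X; rewrite inE mem_cat mem_head !orbT.
move: pX lX; rewrite cat_path lS /= last_cat => /and3P[pS _ pS'] /= lS'.
have lZ : last (north i) (Y ++ down i ++ S') = south i.
  by rewrite !last_cat lY last_down.
have up_sub : {subset up i <= north i :: down i}.
  move=> z z_up; rewrite -mem_rev -backwardE last_down.
  by rewrite in_cons z_up orbT.
(* Dropping [up i] loses no vertex, since [down i] already covers the aisle. *)
have mem_z : {subset Q <= north i :: (Y ++ down i ++ S') ++ south k :: S}.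
  move=> z /sub_o z_in; have south_z : z = south i -> z \in north i :: down i.
    by move->; rewrite -[X in X \in _]last_down mem_last.
  move: z_in south_z (@up_sub z); rewrite !(in_cons, mem_cat).
  case/or4P=> [->|->|/or4P[->|->|/eqP zS|->]|/orP[zU|->]] Sz Uz;
    rewrite ?orbT //.
    by case/orP: (Sz zS) => ->; rewrite ?orbT.
  by case/orP: (Uz zU) => ->; rewrite ?orbT.
(* The new walk runs from [north k] to [north i], then through [Y], [down i] and [S'], over to
   [south k], through [S] and up aisle [k]. Its length is that of the old walk, by the equal lengths
   of aisles and of cross edges. *)
apply: (@no_shifted_traversal i k (Y ++ down i ++ S') S) => //.
- apply: optimal_replace o _ _.
    split.
    + rewrite /= cat_path lZ !cat_path lY last_down pY pD pS' /=.
      by rewrite cat_path lS pS path_up adj_north 1?consecutiveC // adj_south.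
    + by rewrite /= last_cat /= last_cat lS last_up.
    + move=> z /mem_z z_in; rewrite in_cons -!cat_cons catA mem_cat.
      by rewrite z_in !orbT.
  rewrite !(path_length_cons, path_length_cat) lZ lY last_down.
  rewrite /= last_cat /= lS lS' last_up.
  rewrite (path_length_up k) (path_length_down k i) path_length_up.
  rewrite (edge_lengthC (north k)) (edge_lengthC (south k)).
  rewrite (edge_length_cross cik).
  by lra.
Qed.
End OptimalPickingWalks.

(** * Occurrences of a block in a walk *)

Section Occurrences.
Variables (R : realFieldType) (W : warehouse R).
Implicit Types (x y z : location W) (s p q : seq (location W)).

Lemma occurrences_cons s z p :
  occurrences s (z :: p) = (prefix s (z :: p) + occurrences s p)%N.
Proof.
rewrite /occurrences /=; congr addn.
by rewrite -[1%N]addn0 iotaDl count_map; apply: eq_count => k.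
Qed.

(** Each occurrence begins with a step from [x] to [y], and distinct occurrences begin at distinct
    positions, even if they overlap. *)
Lemma occurrences_steps x y s z p :
  (occurrences (x :: y :: s) (z :: p) <= count_mem (x, y) (steps z p))%N.
Proof.
elim: p z => [|t p IH] z; first by rewrite occurrences_cons /= andbF.
rewrite occurrences_cons steps_cons; apply: leq_add (IH t).
rewrite /= xpair_eqE eq_sym (eq_sym y).
by case: (z == x); case: (t == y); rewrite ?leq_b1.
Qed.

Lemma occurrence_exists s p :
  (0 < occurrences s p)%N -> exists A B, p = A ++ s ++ B.
Proof.
rewrite -has_count => /hasP[k _ /prefixP[B def_B]].
by exists (take k p), B; rewrite -def_B cat_take_drop.
Qed.

End Occurrences.

(** * Splitting a list at two blocks *)

Section Splitting.
Variable T : eqType.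
Implicit Types (x y : T) (s A B C D U : seq T).

Lemma cat_eq_cat s A B C :
    (size s <= size B)%N -> s ++ A = B ++ C ->
  exists2 D, B = s ++ D & A = D ++ C.
Proof.
elim: s B => [|x s IH] [|y B] //= le_sB; first by move->; exists [::].
  by move->; exists (y :: B).
by case=> -> /IH[//|D -> ->]; exists D.
Qed.

Lemma cons_eq_cat_cons x y A B C :
  x :: A = B ++ y :: C -> exists2 D, A = D ++ C & last x D = y.
Proof.
case: B => [|z B] [-> ->]; first by exists [::].
by exists (rcons B y); rewrite ?cat_rcons ?last_rcons.
Qed.

(** In the duplicate-free block [x :: D], the vertex [y] occurs only at the end, so the block
    [y :: U] cannot start before that. If the two blocks share this [y], then [X] is empty. *)
Lemma later_occurrence x y D U A A' B B' :
    A ++ (x :: D) ++ B = A' ++ (y :: U) ++ B' ->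
    last x D = y -> uniq (x :: D) -> (size A <= size A')%N ->
  exists2 X, B = X ++ U ++ B' & last y X = y.
Proof.
move=> eqw lD; rewrite lastI rcons_uniq lD => /andP[y_notin _].
case/(cat_eq_cat)/(_ eqw) => E _; rewrite [x :: D]lastI lD.
rewrite cat_rcons => eqE; have le_E : (size (belast x D) <= size E)%N.
  rewrite leqNgt; apply/negP => lt_E; case/negP: y_notin.
  have := congr1 (fun s => nth y s (size E)) eqE.
  rewrite !nth_cat lt_E ltnn subnn /= => <-; exact: mem_nth.
have [F _] := cat_eq_cat le_E eqE.
by move/cons_eq_cat_cons.
Qed.

End Splitting.

(** * From picking walks to closed walks, and the final count *)

Section Main.
Variables (R : realFieldType) (W : warehouse R).

(** Requiring a visit to the origin replaces the fixed start: a closed walk through the origin can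
    be rotated to start there, with the same length. *)
Lemma optimal_walk_closed (Q : {set location W}) p :
    optimal_walk Q (origin W :: p) ->
  optimal_closed_walk (@adj R W) (@edge_length R W) [in origin W |: Q]
    (origin W) p.
Proof.
case=> -[_ [[<-] pp lp Qp]] min_w; split.
  split=> // z; rewrite inE in_setU1 => /orP[/eqP->|/Qp //].
  exact: mem_head.
move=> y q cq; have [_ ly Qq] := cq.
have: origin W \in y :: q by apply: Qq; rewrite !inE eqxx.
move=> /splitPl oq; case: oq cq ly {Qq} => q1 q2 lq1 cq ly.
have [pq lq Qq] := closed_walk_rotate cq; rewrite lq1 in pq lq Qq.
rewrite -(path_length_rotate _ ly) lq1; apply: (min_w (origin W :: q2 ++ q1)).
exists (q2 ++ q1); split=> // z zQ.
by apply: Qq; rewrite !inE zQ orbT.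
Qed.

Lemma uniq_subaisle (i : 'I_(naisles W)) : uniq (subaisle i).
Proof.
rewrite subaisleE map_inj_in_uniq ?iota_uniq // => t u.
rewrite !mem_iota /= !add0n !ltnS; exact: nth_location_inj.
Qed.

End Main.

Theorem theorem5p1 (R : realFieldType) (W : warehouse R)
    (Q : {set location W}) (hQ : Q \subset picking_locations W)
    (w : seq (location W)) (hw : optimal_walk Q w)
    (i : 'I_(naisles W)) :
  (traversals i w <= 1)%N.
Proof.
have [[p [def_w _ _ _]] _] := hw; subst w.
have o := optimal_walk_closed hw.
have uniq_p := optimal_uniq_steps (@adjC R W) (@edge_lengthC R W)
  (@edge_length_gt0 R W) o.
have Q_south k : south k \notin [in origin W |: Q].
  rewrite !inE south_neq_north /=; apply/negP => /(subsetP hQ).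
  by rewrite inE /rank_of /= ltnn.
have once x y s : (occurrences [:: x, y & s] (origin W :: p) <= 1)%N.
  apply: leq_trans (occurrences_steps _ _ _ _ _) _.
  by rewrite count_uniq_mem // leq_b1.
rewrite leqNgt; apply/negP => twice.
have [down1 up1] : (0 < occurrences (subaisle i) (origin W :: p))%N /\
    (0 < occurrences (rev (subaisle i)) (origin W :: p))%N.
  have := once (south i) (above i) (backward (north i) (upper i)).
  rewrite -upE -rev_subaisle.
  have : (occurrences (subaisle i) (origin W :: p) <= 1)%N.
    (* An empty [down i] would give [north i = south i]; otherwise the block has two leading
       vertices and [once] applies. *)
    by rewrite subaisle_down; case: (down i) (last_down i) => // /eqP.
  by move: twice; rewrite /traversals; lia.
have [A [B defD]] := occurrence_exists down1.
have [A' [B' defU]] := occurrence_exists up1.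
rewrite rev_subaisle in defU; rewrite subaisle_down in defD.
have uD := uniq_subaisle i; have uU := uD.
rewrite -rev_uniq rev_subaisle in uU; rewrite subaisle_down in uD.
have eqDU := defD; rewrite defU in eqDU.
have [le_A | /ltnW le_A] := leqP (size A) (size A').
  have [X def_B lX] := later_occurrence (esym eqDU) (last_down i) uD le_A.
  rewrite {}def_B in defD; have [p1 def_p lp1] := cons_eq_cat_cons defD.
  rewrite {}def_p in o; move/optimal_rotate: o; rewrite lp1 -!catA => o.
  exact: (no_opposite_traversals (i := i) (X := X) Q_south o lX).
(* If the traversal upwards comes first, the part between the two is the loop at [north i], and the
   remainder [B ++ p1] is the loop at [south i]. A second rotation then puts [down i] first. *)
have [X def_B lX] := later_occurrence eqDU (last_up i) uU le_A.
rewrite {}def_B in defU; have [p1 def_p lp1] := cons_eq_cat_cons defU.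
rewrite {}def_p in o; move/optimal_rotate: o; rewrite lp1 -!catA => o.
have [[_ lo _] _] := o.
have lY : last (south i) (B ++ p1) = south i.
  by rewrite -[RHS]lo !last_cat last_up lX last_down.
rewrite catA in o; move/optimal_rotate: o; rewrite last_cat last_up lX => o.
apply: (no_opposite_traversals (i := i) (X := B ++ p1) (Y := X) Q_south _ lY).
by rewrite -!catA in o *.
Qed.
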